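(* Let $\mathcal Z=\mathbb R^{d_z}$, let $\mathcal C\subset\mathcal Z$ be a nonempty closed convex set, let $\mathbf P$ be a symmetric positive definite $d_z\times d_z$ matrix, let $n\ge1$, and let $p=\sum_{i=1}^n p_i$ and $Q=\sum_{i=1}^nQ_i$ with differentiable $p_i:\mathcal Z\to\mathbb R$ and $Q_i:\mathcal Z\to\mathcal Z$. Let $L_i,M_i\ge0$ with $L_i+M_i>0$ ($1\le i\le n$), and assume that for every $i$ the gradient $\nabla p_i$ is monotone and $L_i$-Lipschitz with respect to $\|\cdot\|_{\mathbf P}$, and the operator $Q_i$ is monotone and $M_i$-Lipschitz with respect to $\|\cdot\|_{\mathbf P}$. Let $(\alpha_t)_{t\ge0}$ be defined by $$\alpha_0=1,\qquad \alpha_{t+1}=\frac{2}{1+\sqrt{1+4/\alpha_t^2}}\quad\text{for }t\ge0.$$ Let $T_1,\dots,T_n$ be positive integers, let $z_{\rm in}\in\mathcal C$, and let $z_{\rm out}$ be the output of Algorithm 1 (described in the context) with input $z_{\rm in}$ and parameters $(\alpha_t)$, $(L_i)$, $(M_i)$, $(T_k)$, $\mathbf P$. Then $z_{\rm out}\in\mathcal C$, and for all $z\in\mathcal C$ $$p(z_{\rm out})-p(z)+\langle Q(z),z_{\rm out}-z\rangle\ \le\ \sum_{i=1}^n\left(\frac{4^iL_i}{\prod_{j=1}^iT_j^2}+\frac{2^iM_i}{\prod_{j=1}^iT_j}\right)\cdot\frac12\|z_{\rm in}-z\|_{\mathbf P}^2 .$$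
   Context: $\|z\|_{\mathbf P}=\sqrt{\langle\mathbf Pz,z\rangle}$ and $\|z\|_{\mathbf P^{-1}}=\sqrt{\langle\mathbf P^{-1}z,z\rangle}$. An operator $G:\mathbb R^d\to\mathbb R^d$ is monotone if $\langle G(x)-G(x'),x-x'\rangle\ge0$ for all $x,x'$; it is $M$-Lipschitz with respect to $\|\cdot\|_{\mathbf P}$ if $\|G(x)-G(x')\|_{\mathbf P^{-1}}\le M\|x-x'\|_{\mathbf P}$ for all $x,x'$. **Algorithm 1.** Write $t_{1:k}$ for $t_1,\dots,t_k$ (empty if $k=0$). The algorithm uses points $z^k_{s_1,\dots,s_k}\in\mathcal Z$ indexed by $k$-tuples, $1\le k\le n$, and functions $p_i^{k;t_{1:k}}:\mathcal Z\to\mathbb R$. Initialization: $z^i_{0,\dots,0}=z_{\rm in}$ ($i$ zero indices) and $p_i^{0}\equiv p_i$ for $i=1,\dots,n$. Output: $z_{\rm out}=\mathrm{Rec}(1)$. The recursive procedure $\mathrm{Rec}(k;t_{1:k-1})$ is: - If $k=n+1$: return $\arg\min_{z\in\mathcal C}\sum_{i=1}^np_i^{n;t_{1:n}}(z)$. - Otherwise set $\bar z^k_0=z^k_{t_{1:k-1},0}$ and, for $t_k=0,1,\dots,T_k-1$, do the following: 1. For $i=1,\dots,n$ set $\hat p_i^{k;t_{1:k}}(z)=\alpha_{t_k}^{-1}\,p_i^{k-1;t_{1:k-1}}\big(\alpha_{t_k}z+(1-\alpha_{t_k})\bar z^k_{t_k}\big)$ if $i\ge k$, and $\hat p_i^{k;t_{1:k}}(z)=p_i^{k-1;t_{1:k-1}}(z)$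 if $i<k$; $L_i^{k;t_{1:k}}=L_i\prod_{l=1}^k\alpha_{t_l}$, $M_i^{k;t_{1:k}}=M_i\prod_{l=1}^k(\alpha_{t_l}/\alpha_{T_l-1})$, $H_i^{k;t_{1:k}}=L_i^{k;t_{1:k}}+M_i^{k;t_{1:k}}$; $\Delta_i^{k;t_{1:k}}=\nabla\hat p_i^{k;t_{1:k}}(z^k_{t_{1:k}})+Q_i(z^k_{t_{1:k}})$ (used only for $i=k$); $p_k^{k;t_{1:k}}(z)=\tfrac12H_k^{k;t_{1:k}}\|z-z^k_{t_{1:k}}\|_{\mathbf P}^2+\langle z,\Delta_k^{k;t_{1:k}}\rangle$, and $p_i^{k;t_{1:k}}\equiv\hat p_i^{k;t_{1:k}}$ for $i\ne k$. 2. $z^k_{t_{1:k-1},t_k+1/2}=\mathrm{Rec}(k+1;t_{1:k})$. 3. $\bar z^k_{t_k+1}=\alpha_{t_k}z^k_{t_{1:k-1},t_k+1/2}+(1-\alpha_{t_k})\bar z^k_{t_k}$. 4. $\Delta_{Q_k}^{k;t_{1:k}}=Q_k(z^k_{t_{1:k}})-Q_k(z^k_{t_{1:k-1},t_k+1/2})$. 5. $z^k_{t_{1:k-1},t_k+1}=z^k_{t_{1:k-1},t_k+1/2}+(H_k^{k;t_{1:k}}\mathbf P)^{-1}\Delta_{Q_k}^{k;t_{1:k}}$. 6. For $l=k+1,\dots,n$: $z^l_{t_{1:k-1},t_k+1,0,\dots,0}=z^l_{t_{1:k-1},t_k,T_{k+1},0,\dots,0}$. After the loop return $\bar z^k_{T_k}$.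 *)

(* Defs.v *)
From HB Require Import structures.
From mathcomp Require Import all_boot all_order all_algebra.
From mathcomp Require Import all_classical all_reals all_analysis.
Import Order.TTheory GRing.Theory Num.Theory.
Import numFieldNormedType.Exports.

Set Implicit Arguments.
Unset Strict Implicit.
Unset Printing Implicit Defensive.

Local Open Scope classical_set_scope.
Local Open Scope ring_scope.

(* Points of R^d are row vectors, so for a symmetric matrix A the vector A z
   is written [z *m A]. *)

Definition inner (R : realType) (d : nat) (x y : 'rV[R]_d) : R :=
  \sum_j x 0 j * y 0 j.

Definition wnorm (R : realType) (d : nat) (A : 'M[R]_d) (z : 'rV[R]_d) : R :=
  Num.sqrt (inner (z *m A) z).

Definition sym_posdef (R : realType) (d : nat) (A : 'M[R]_d) : Prop :=
  A^T = A /\ forall z : 'rV[R]_d, z != 0 -> 0 < inner (z *m A) z.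

Definition monotone_op (R : realType) (d : nat)
    (G : 'rV[R]_d -> 'rV[R]_d) : Prop :=
  forall x x', 0 <= inner (G x - G x') (x - x').

Definition lipschitz_op (R : realType) (d : nat) (P : 'M[R]_d) (M : R)
    (G : 'rV[R]_d -> 'rV[R]_d) : Prop :=
  forall x x', wnorm (invmx P) (G x - G x') <= M * wnorm P (x - x').

Definition grad (R : realType) (d : nat) (f : 'rV[R]_d -> R)
    (x : 'rV[R]_d) : 'rV[R]_d :=
  \row_j 'd f x (delta_mx 0 j).

(* Some minimizer of [f] over [C]; the value 0 when there is none is junk. *)
Definition argmin (R : realType) (d : nat) (C : set 'rV[R]_d)
    (f : 'rV[R]_d -> R) : 'rV[R]_d :=
  xget 0 [set z | C z /\ forall y, C y -> f z <= f y].

Fixpoint step_size (R : realType) (t : nat) : R :=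
  if t is t'.+1 then 2 / (1 + Num.sqrt (1 + 4 / step_size R t' ^+ 2)) else 1.

Section Algorithm.
Variables (R : realType) (d : nat).
Local Notation Z := 'rV[R]_d.

(* The components p_i, Q_i and the constants L_i, M_i, T_k are indexed from 1;
   their values outside 1..n are never used.
   A multi-index (t_1, ..., t_k) is a sequence of length k, and the points
   z^k_{t_1, ..., t_k} generated so far are held in a store [seq nat -> Z],
   the superscript k being the length of the key. *)
Variables (n : nat) (C : set Z) (P : 'M[R]_d).
Variables (Q : nat -> Z -> Z) (L M : nat -> R).
Variables (alpha : nat -> R) (T : nat -> nat).

Definition set_point (z : seq nat -> Z) (s : seq nat) (x : Z) : seq nat -> Z :=
  fun s' => if s' == s then x else z s'.

Definition Hcoef (i : nat) (t : seq nat) : R :=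
  L i * \prod_(1 <= l < (size t).+1) alpha (nth 0%N t l.-1) +
  M i * \prod_(1 <= l < (size t).+1)
          (alpha (nth 0%N t l.-1) / alpha (T l).-1).

(* [phat] and [pnew] build \hat p_i^{k;t_{1:k}} and p_i^{k;t_{1:k}}, where
   t = t_{1:k}, from p = (p_i^{k-1;t_{1:k-1}})_i, zbar = \bar z^k_{t_k} and
   zt = z^k_{t_{1:k}}. *)
Definition phat (t : seq nat) (zbar : Z) (p : nat -> Z -> R) : nat -> Z -> R :=
  fun i z =>
    let a := alpha (last 0%N t) in
    if (size t <= i)%N then a^-1 * p i (a *: z + (1 - a) *: zbar) else p i z.

Definition pnew (t : seq nat) (zbar zt : Z) (p : nat -> Z -> R) :
    nat -> Z -> R :=
  fun i z =>
    let k := size t in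
    if i == k then
      2^-1 * Hcoef k t * wnorm P (z - zt) ^+ 2 +
      inner z (grad (phat t zbar p k) zt + Q k zt)
    else phat t zbar p i z.

(* [Rec m t p z] is Rec(k; t) for t = t_{1:k-1} and m = n + 1 - k, run with
   p = (p_i^{k-1;t})_i from the store z; it returns the result together with
   the final store. *)
Fixpoint Rec (m : nat) (t : seq nat) (p : nat -> Z -> R) (z : seq nat -> Z) :
    Z * (seq nat -> Z) :=
  if m is m'.+1 then
    let k := (size t).+1 in
    iteri (T k) (fun tk zbar_z =>
      let: (zbar, z) := zbar_z in
      let tcur := rcons t tk in
      let tnext := rcons t tk.+1 in
      let: (zhalf, z) := Rec m' tcur (pnew tcur zbar (z tcur) p) z in
      let zbar := alpha tk *: zhalf + (1 - alpha tk) *: zbar in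
      let DQ := Q k (z tcur) - Q k zhalf in
      let z := set_point z tnext (zhalf + DQ *m invmx (Hcoef k tcur *: P)) in
      let z := foldl (fun z l =>
        set_point z (tnext ++ nseq (l - k) 0%N)
          (z (tcur ++ T k.+1 :: nseq (l - k.+1) 0%N))) z (index_iota k.+1 n.+1) in
      (zbar, z)) (z (rcons t 0%N), z)
  else (argmin C (fun x => \sum_(1 <= i < n.+1) p i x), z).

(* Keys other than (0, ..., 0) initially hold a dummy 0. *)
Definition algorithm (p : nat -> Z -> R) (zin : Z) : Z :=
  (Rec n [::] p (fun s => if all (pred1 0%N) s then zin else 0)).1.

End Algorithm.

(* Main.v *)
Require Import Defs.
From HB Require Import structures.
From mathcomp Require Import all_boot all_order all_algebra.
From mathcomp Require Import all_classical all_reals all_analysis.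
From mathcomp Require Import ring lra zify.
Import Order.TTheory GRing.Theory Num.Theory.
Import numFieldNormedType.Exports.

Set Implicit Arguments.
Unset Strict Implicit.
Unset Printing Implicit Defensive.

Local Open Scope classical_set_scope.
Local Open Scope ring_scope.

(** Fix a comparison point [x] in [C].  At level [k] the components [p_i] with
    [i >= k] are still convex with a known quadratic upper model, while those
    with [i < k] have been replaced by quadratics [h_i/2 |z - c_i|^2 + <z, b_i>].
    By induction from the innermost level, the output [w] of [Rec] satisfies
      [sum_i (f_i w - f_i x) + sum_(i < k) h_i/2 |w - x|^2
         + sum_(i >= k) <Q_i x, w - x> <= decrease of weighted |z^l - x|^2].
    The innermost level is the strong convexity inequality at a minimizer.  One
    iteration at level [k] trades the quadratic that replaced [p_k] for
    [p_k + <Q_k x, .>] (descent lemma plus an extragradient correction) and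
    averages with weight [a_t]; the left-hand side is convex in [w], so it
    telescopes after division by [a_t^2], since
    [(1 - a_(t+1)) / a_(t+1)^2 = 1 / a_t^2].  The telescoping also needs the
    weights of the distances, divided by [a_t], not to depend on [t]; this is
    what the scaling of [H] achieves.  Finally [a_(T-1) <= 2 / (T + 1)]. *)

(** * Bilinearity of the Euclidean inner product *)

Section InnerProduct.
Variables (R : realType) (d : nat).
Implicit Types (x y z : 'rV[R]_d) (a : R) (A : 'M[R]_d).

Lemma innerC x y : inner x y = inner y x.
Proof. by apply: eq_bigr => j _; rewrite mulrC. Qed.

Lemma innerDl x y z : inner (x + y) z = inner x z + inner y z.
Proof. by rewrite -big_split; apply: eq_bigr => j _; rewrite mxE mulrDl. Qed.

Lemma innerZl a x y : inner (a *: x) y = a * inner x y.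
Proof. by rewrite mulr_sumr; apply: eq_bigr => j _; rewrite mxE mulrA. Qed.

Lemma innerNl x y : inner (- x) y = - inner x y.
Proof. by rewrite -scaleN1r innerZl mulN1r. Qed.

Lemma innerDr x y z : inner x (y + z) = inner x y + inner x z.
Proof. by rewrite innerC innerDl !(innerC x). Qed.

Lemma innerZr a x y : inner x (a *: y) = a * inner x y.
Proof. by rewrite innerC innerZl innerC. Qed.

Lemma innerNr x y : inner x (- y) = - inner x y.
Proof. by rewrite innerC innerNl innerC. Qed.

Lemma inner0l x : inner 0 x = 0.
Proof. by rewrite -(scale0r x) innerZl mul0r. Qed.

Lemma inner_suml (I : Type) (r : seq I) (F : I -> 'rV[R]_d) y :
  inner (\sum_(i <- r) F i) y = \sum_(i <- r) inner (F i) y.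
Proof.
elim: r => [|i r IH]; first by rewrite !big_nil inner0l.
by rewrite !big_cons innerDl IH.
Qed.

Lemma inner_delta x j : inner x (delta_mx 0 j) = x 0 j.
Proof.
rewrite /inner (bigD1 j) //= mxE !eqxx mulr1 big1 ?addr0 // => i /negbTE ij.
by rewrite mxE ij andbF mulr0.
Qed.

Lemma inner_mulmxl A x y : inner (x *m A) y = inner x (y *m A^T).
Proof.
rewrite /inner.
under eq_bigr do rewrite mxE mulr_suml.
under [RHS]eq_bigr do rewrite mxE mulr_sumr.
rewrite exchange_big; apply: eq_bigr => i _; apply: eq_bigr => j _.
by rewrite mxE mulrA mulrAC.
Qed.

End InnerProduct.

(** * The norm of [P] and its dual *)

Section WeightedNorm.
Variables (R : realType) (d : nat) (P : 'M[R]_d).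
Hypothesis hP : sym_posdef P.
Implicit Types (x y z u : 'rV[R]_d).

Definition wip x y : R := inner (x *m P) y.

Lemma wipC x y : wip x y = wip y x.
Proof. by rewrite /wip inner_mulmxl hP.1 innerC. Qed.

Lemma wipDl x y z : wip (x + y) z = wip x z + wip y z.
Proof. by rewrite /wip mulmxDl innerDl. Qed.

Lemma wipZl a x y : wip (a *: x) y = a * wip x y.
Proof. by rewrite /wip -scalemxAl innerZl. Qed.

Lemma wipNl x y : wip (- x) y = - wip x y.
Proof. by rewrite /wip mulNmx innerNl. Qed.

Lemma wipDr x y z : wip x (y + z) = wip x y + wip x z.
Proof. exact: innerDr. Qed.

Lemma wipZr a x y : wip x (a *: y) = a * wip x y.
Proof. exact: innerZr. Qed.

Lemma wipNr x y : wip x (- y) = - wip x y.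
Proof. exact: innerNr. Qed.

Definition wipE := (wipDl, wipDr, wipNl, wipNr, wipZl, wipZr).
Definition innerE := (innerDl, innerDr, innerNl, innerNr, innerZl, innerZr).

Lemma wip_ge0 x : 0 <= wip x x.
Proof.
by have [->|/hP.2/ltW//] := eqVneq x 0; rewrite /wip mul0mx inner0l.
Qed.

Lemma posdef_unitmx : P \in unitmx.
Proof.
rewrite -row_free_unit -kermx_eq0; apply/negPn/negP => /rowV0Pn [v].
move=> /sub_kermxP vP v0; have := hP.2 _ v0.
by rewrite vP inner0l ltxx.
Qed.

Lemma mulmx_invK x : x *m invmx P *m P = x.
Proof. by rewrite -mulmxA mulVmx ?mulmx1 ?posdef_unitmx. Qed.

Lemma inner_wip x y : inner x y = wip (x *m invmx P) y.
Proof. by rewrite /wip mulmx_invK. Qed.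

Lemma wnorm_sq x : wnorm P x ^+ 2 = wip x x.
Proof. by rewrite sqr_sqrtr // wip_ge0. Qed.

Lemma wnorm_ge0 (A : 'M[R]_d) x : 0 <= wnorm A x.
Proof. exact: sqrtr_ge0. Qed.

Lemma wnorm_inv x : wnorm (invmx P) x = wnorm P (x *m invmx P).
Proof. by rewrite /wnorm mulmx_invK innerC. Qed.

Lemma wnormZ a x : wnorm P (a *: x) = `|a| * wnorm P x.
Proof.
rewrite /wnorm.
have -> : inner ((a *: x) *m P) (a *: x) = a ^+ 2 * inner (x *m P) x.
  by rewrite innerZr -scalemxAl innerZl mulrA.
by rewrite sqrtrM ?sqr_ge0// sqrtr_sqr.
Qed.

(* From [0 <= | |y| x - |x| y |^2]. *)
Lemma wip_le x y : wip x y <= wnorm P x * wnorm P y.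
Proof.
have [x0|x0] := eqVneq x 0.
  by rewrite x0 /wip mul0mx inner0l mulr_ge0 ?wnorm_ge0.
have [y0|y0] := eqVneq y 0.
  by rewrite y0 wipC /wip mul0mx inner0l mulr_ge0 ?wnorm_ge0.
have hx : 0 < wnorm P x by rewrite sqrtr_gt0 hP.2.
have hy : 0 < wnorm P y by rewrite sqrtr_gt0 hP.2.
have := wip_ge0 (wnorm P y *: x - wnorm P x *: y).
rewrite !wipE -!wnorm_sq (wipC y x) => h.
rewrite -(ler_pM2l (mulr_gt0 hx hy)); nra.
Qed.

(** Cauchy-Schwarz for [P], applied to [P^-1 x] and [y]: the norm of [P^-1] is the dual norm. *)
Lemma inner_le x y : inner x y <= wnorm (invmx P) x * wnorm P y.
Proof. by rewrite inner_wip wnorm_inv wip_le. Qed.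

End WeightedNorm.

(** * Gradients along lines and under affine substitutions *)

Section Gradient.
Variables (R : realType) (d : nat).
Implicit Types (f : 'rV[R]_d -> R) (x y v : 'rV[R]_d).

Lemma diff_grad f x v : 'd f x v = inner (grad f x) v.
Proof.
rewrite [in LHS](row_sum_delta v) linear_sum /inner; apply: eq_bigr => j _.
by rewrite linearZ mxE /= mulrC.
Qed.

Lemma is_derive_line f x v (t : R) :
  (forall z, differentiable f z) ->
  is_derive t 1 (fun s => f (x + s *: v)) (inner (grad f (x + t *: v)) v).
Proof.
move=> df.
pose g (s : R) := x + s *: v.
have dg : is_diff t g (fun s => s *: v).
  rewrite /g (_ : (fun s => s *: v) = 0 + *:%R^~ v); last first.
    by apply/funext => s /=; rewrite /GRing.add /= add0r.
  exact: is_diffD.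
have df' := differentiableP (df (g t)).
have h := is_diff_comp dg df'.
have dh : differentiable (f \o g) t by apply: ex_diff.
split; first exact: diff_derivable.
rewrite deriveE //.
by rewrite (@diff_val _ _ _ _ _ _ _ h) /= scale1r diff_grad.
Qed.

Lemma grad_affine f a b x (c : R) : (forall z, differentiable f z) ->
  let g := fun z => c * f (a *: z + b) in
  (forall z, differentiable g z) /\ grad g x = (c * a) *: grad f (a *: x + b).
Proof.
move=> df g.
have dg z : is_diff z g (fun v => (c * a) * inner (grad f (a *: z + b)) v).
  pose h z := a *: z + b.
  have dh : is_diff z h ( *:%R a).
    rewrite (_ : *:%R a = *:%R a + 0) //.
      exact: is_diffD.
    by apply/funext => s /=; rewrite /GRing.add /= addr0.
  have := is_diffZ c (is_diff_comp dh (differentiableP (df (h z)))).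
  congr is_diff_def; apply/funext => v /=.
  by rewrite -mulrA -innerZr -diff_grad.
split=> [z|]; first by apply: ex_diff.
apply/rowP => j; rewrite [LHS]mxE [RHS]mxE (@diff_val _ _ _ _ _ _ _ (dg x)).
by rewrite inner_delta.
Qed.

End Gradient.

(** * Smooth convex functions, quadratics and their minimizers *)

Section Smoothness.
Variables (R : realType) (d : nat) (P : 'M[R]_d).
Hypothesis hP : sym_posdef P.
Implicit Types (f : 'rV[R]_d -> R) (x y v : 'rV[R]_d).

(** The two first-order models are all that the analysis uses of a monotone Lipschitz gradient, and
    they rescale well. *)
Definition convex_smooth (l : R) f :=
  (forall x, differentiable f x) /\
  forall x y, f x + inner (grad f x) (y - x) <= f y <=
    f x + inner (grad f x) (y - x) + 2^-1 * l * wip P (y - x) (y - x).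

(** The mean value theorem for [f (x + t v) - k t^2], with [v = y - x]. The free [k] replaces an
    integration of the gradient when the sharp factor 1/2 is wanted. *)
Lemma mean_value_line f x y (k : R) : (forall z, differentiable f z) ->
  exists u s, [/\ 0 < s, u - x = s *: (y - x) &
    f y - f x = inner (grad f u) (y - x) + k * (1 - 2 * s)].
Proof.
move=> df; pose v := y - x.
pose g (t : R) := f (x + t *: v) - k * t ^+ 2.
have D (t : R) : is_derive t 1 g (inner (grad f (x + t *: v)) v - k * (2 * t)).
  have h1 := is_derive_line x v t df.
  have h2 : is_derive t 1 (fun s : R => k * s ^+ 2) (k * (2 * t)).
    have -> : (fun s : R => k * s ^+ 2) = k \*: (id ^+ 2) :> (R -> R).
      by apply/funext.
    apply: (is_derive_eq (is_deriveZ k (is_deriveX 2 (is_derive_id t 1)))).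
    by rewrite -![_ *: _]/(_ * _) /= expr1 mulr1; ring.
  exact: is_deriveB h1 h2.
have gc : {within `[0, 1], continuous g}.
  apply: derivable_within_continuous => t _.
  exact: (@ex_derive _ _ _ _ _ _ _ (D t)).
have [s] := MVT ltr01 (fun t _ => D t) gc.
rewrite in_itv /= => /andP[s0 _] e.
exists (x + s *: v), s; split=> //; first by rewrite addrC addKr.
move: e; rewrite /g scale0r addr0 scale1r [x + v]addrC subrK expr0n expr1n.
rewrite subr0 !mulr1 /= mulr0 subr0.
move: (inner _ _) (f y) (f x) => A B C; clear; lra.
Qed.

Lemma convex_smooth_lipschitz f l : (forall x, differentiable f x) ->
  monotone_op (grad f) -> lipschitz_op P l (grad f) -> convex_smooth l f.
Proof.
move=> df fmono flip; split=> // x y; apply/andP; split.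
  have [u [s [s0 us e]]] := mean_value_line x y 0 df.
  have := fmono u x; rewrite us innerZr innerDl innerNl pmulr_rge0 //.
  move: e; move: (y - x) (grad f u) (grad f x) => v a b.
  move: (inner a v) (inner b v) (f y) (f x) => A B C D; clear; lra.
(* With [k = l |y - x|^2 / 2], the Lipschitz bound [s l |y - x|^2] and the term [k (1 - 2 s)] add up
   to [l |y - x|^2 / 2], whatever [s] is. *)
have [u [s [s0 us e]]] := mean_value_line x y (2^-1 * l * wip P (y - x) (y - x)) df.
have := inner_le hP (grad f u - grad f x) (y - x).
move/le_trans/(_ (ler_wpM2r (wnorm_ge0 P _) (flip u x))).
rewrite us wnormZ gtr0_norm // innerDl innerNl.
move: e; rewrite -(wnorm_sq hP).
move: (y - x) (grad f u) (grad f x) => v a b.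
move: (inner a v) (inner b v) (f y) (f x) (wnorm P v) => A B C D N; clear -s0.
nra.
Qed.

(** The gradient picks up [a^-1 a = 1] and the quadratic term [a^-1 a^2 = a]. Hence each level
    multiplies the smoothness constant by its step size. *)
Lemma convex_smooth_affine f l a b : 0 < a -> convex_smooth l f ->
  convex_smooth (a * l) (fun z => a^-1 * f (a *: z + b)).
Proof.
move=> a0 [df hf]; split; first exact: (grad_affine a b 0 a^-1 df).1.
move=> x y; rewrite (grad_affine a b x a^-1 df).2 mulVf ?gt_eqF // scale1r.
have := hf (a *: x + b) (a *: y + b).
have -> : a *: y + b - (a *: x + b) = a *: (y - x).
  by rewrite scalerBr opprD addrACA subrr addr0.
rewrite innerZr wipZl (wipZr P) => /andP[h1 h2].
apply/andP; split; rewrite -(ler_pM2l a0) !mulrDr !mulVKf ?gt_eqF //.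
by apply: le_trans h2 _; rewrite le_eqVlt; apply/orP; left; apply/eqP; ring.
Qed.

Definition quadratic (h : R) f :=
  exists b e, forall z, f z = 2^-1 * h * wip P z z + inner z b + e.

Lemma quadratic_dist h c b :
  quadratic h (fun z => 2^-1 * h * wnorm P (z - c) ^+ 2 + inner z b).
Proof.
exists (b - h *: (c *m P)), (2^-1 * h * wip P c c) => z.
rewrite (wnorm_sq hP) !wipE !innerE (wipC hP z c) (innerC z (c *m P)).
by rewrite -/(wip P c z); field.
Qed.

Lemma quadratic_sum (r : seq nat) (h : nat -> R) (f : nat -> 'rV[R]_d -> R) :
  (forall i, i \in r -> quadratic (h i) (f i)) ->
  quadratic (\sum_(i <- r) h i) (fun z => \sum_(i <- r) f i z).
Proof.
elim: r => [_|i r IH H].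
  exists 0, 0 => z; rewrite !big_nil innerC inner0l; ring.
have [b [e Hi]] := H i (mem_head _ _).
have [|b' [e' Hr]] := IH; first by move=> j jr; apply: H; rewrite inE jr orbT.
exists (b + b'), (e + e') => z; rewrite !big_cons Hi Hr innerDr; ring.
Qed.

Lemma quadratic_convex_comb h f x y (a : R) : quadratic h f ->
  f (a *: x + (1 - a) *: y) =
  a * f x + (1 - a) * f y - a * (1 - a) * (2^-1 * h * wip P (x - y) (x - y)).
Proof.
move=> [b [e H]]; rewrite !H !wipE !innerE (wipC hP y x).
by field.
Qed.

Lemma continuous_inner (f g : 'rV[R]_d -> 'rV[R]_d) :
  (forall j, continuous (fun z => f z 0 j)) ->
  (forall j, continuous (fun z => g z 0 j)) ->
  continuous (fun z => inner (f z) (g z)).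
Proof.
move=> hf hg; rewrite /inner.
apply: (@continuous_big _ _ +%R 0 _ _ _) => [|j _ z].
  exact: add_continuous.
by apply: continuousM; [exact: hf|exact: hg].
Qed.

Lemma quadratic_continuous h f : quadratic h f -> continuous f.
Proof.
move=> [b [e H]]; have -> : f = fun z => 2^-1 * h * wip P z z + inner z b + e.
  exact/funext.
have cz j : continuous (fun z : 'rV[R]_d => z 0 j) by exact: coord_continuous.
have czP j : continuous (fun z : 'rV[R]_d => (z *m P) 0 j).
  rewrite (_ : (fun z => _) = fun z : 'rV[R]_d => \sum_i z 0 i * P i j); last first.
    by apply/funext => z; rewrite mxE.
  apply: (@continuous_big _ _ +%R 0 _ _ _) => [|i _ z].
    exact: add_continuous.
  by apply: continuousM; [exact: cz|exact: cst_continuous].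
have c1 : continuous (fun z => wip P z z) by exact: (continuous_inner czP cz).
have c2 : continuous (fun z => inner z b).
  by apply: (continuous_inner cz) => j; exact: cst_continuous.
move=> z.
exact: (cvgD (cvgD (cvgM (cvg_cst (2^-1 * h)) (c1 z)) (c2 z)) (cvg_cst e)).
Qed.

Lemma quadratic_sublevel_bounded h f (m : R) : 0 < h -> quadratic h f ->
  bounded_set [set z | f z <= m].
Proof.
move=> h0 [b [e H]].
(* [K] makes [h K = h + 2 (|b| + |m - e|)], with the dual norm of [b]; beyond radius [K >= 1] the
   quadratic term outweighs the rest. *)
pose K := 1 + 2 * (wnorm (invmx P) b + `|m - e|) / h.
pose B := \sum_j wnorm (invmx P) (delta_mx 0 j : 'rV[R]_d) * K.
have K1 : 1 <= K.
  by rewrite lerDl divr_ge0 ?(ltW h0)// mulr_ge0// addr_ge0 ?wnorm_ge0.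
have B0 : 0 <= B.
  by apply: sumr_ge0 => j _; rewrite mulr_ge0 ?wnorm_ge0// (le_trans _ K1).
exists B; split; first exact: ger0_real.
move=> t /ltW Bt z /= fz; apply: le_trans Bt.
have zK : wnorm P z <= K.
  rewrite leNgt; apply/negP => Kz.
  have z1 := lt_le_trans (le_lt_trans K1 Kz) (lexx _).
  have := inner_le hP (- b) z.
  have -> : wnorm (invmx P) (- b) = wnorm (invmx P) b.
    by rewrite /wnorm mulNmx innerNl innerNr opprK.
  rewrite innerNl innerC => hb.
  move: fz; rewrite H -(wnorm_sq hP) => fz.
  have me := ler_norm (m - e).
  have hK : h * K = h + 2 * (wnorm (invmx P) b + `|m - e|).
    by rewrite /K; field; rewrite gt_eqF.
  have := wnorm_ge0 (invmx P) b; have := normr_ge0 (m - e).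
  move: (wnorm (invmx P) b) (wnorm P z) (`|m - e|) hK hb fz me z1 Kz.
  move=> w N q hK hb fz me z1 Kz q0 w0.
  have : h * K < h * N by rewrite ltr_pM2l.
  rewrite hK => hN.
  have : (h + 2 * (w + q)) * N < h * N * N by rewrite ltr_pM2r //; lra.
  nra.
have zj j : `|z 0 j| <= wnorm (invmx P) (delta_mx 0 j : 'rV[R]_d) * K.
  have le_j u : wnorm P u <= K ->
      u 0 j <= wnorm (invmx P) (delta_mx 0 j : 'rV[R]_d) * K.
    move=> uK; rewrite -inner_delta innerC.
    by apply: le_trans (inner_le hP _ _) _; rewrite ler_wpM2l ?wnorm_ge0.
  rewrite ler_norml le_j // andbT lerNl.
  have := le_j (- z); rewrite mxE; apply.
  by rewrite /wnorm mulNmx innerNl innerNr opprK.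
rewrite [leLHS]/Num.norm /= mx_normrE; apply: bigmax_le => // -[i j] _ /=.
rewrite (ord1 i) /B (bigD1 j) //=; apply: (le_trans (zj j)); rewrite lerDl.
by apply: sumr_ge0 => k _; rewrite mulr_ge0 ?wnorm_ge0// (le_trans _ K1).
Qed.

(** Existence comes from compactness of a sublevel set in [C]. The quadratic growth comes from
    comparing [w] with [a x + (1 - a) w] and letting [a] tend to 0. *)
Lemma argmin_quadratic (C : set 'rV[R]_d) h f : C !=set0 -> closed C ->
  (forall x y a, C x -> C y -> 0 <= a -> a <= 1 -> C (a *: x + (1 - a) *: y)) ->
  0 < h -> quadratic h f ->
  let w := argmin C f in
  C w /\ forall x, C x ->
    f w + 2^-1 * h * wip P (w - x) (w - x) <= f x.
Proof.
move=> [x0 Cx0] Ccl Ccvx h0 qf.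
have fc := quadratic_continuous qf.
pose S := C `&` [set z | f z <= f x0].
have [|||u] := @EVT_min_rV R d f S.
- by exists x0; split=> /=.
- apply: bounded_closed_compact.
    have [m [mr hm]] := quadratic_sublevel_bounded (f x0) h0 qf.
    by exists m; split=> // t mt z [_ fz]; exact: hm fz.
  apply: closedI => //.
  apply: (@preimage_closed _ _ f [set y | y <= f x0]); last exact: closed_le.
  by move=> z _; exact: fc.
- exact: continuous_subspaceT.
rewrite inE => -[Cu fu] umin w.
have ex : exists z, C z /\ forall y, C y -> f z <= f y.
  exists u; split=> // y Cy; have [yx|/ltW xy] := leP (f y) (f x0).
    by apply: umin; rewrite inE.
  exact: le_trans xy.
have [Cw wmin] : C w /\ forall y, C y -> f w <= f y.
  exact: (@xgetPex _ 0 [set z | C z /\ forall y, C y -> f z <= f y] ex).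
split=> // x Cx; set D := wip _ _ _.
have D0 : 0 <= D by exact: wip_ge0.
have key a : 0 < a -> a < 1 -> (1 - a) * (2^-1 * h * D) <= f x - f w.
  move=> a0 a1.
  have := wmin _ (Ccvx x w a Cx Cw (ltW a0) (ltW a1)).
  rewrite (quadratic_convex_comb _ _ _ qf) => hh.
  have -> : D = wip P (x - w) (x - w).
    by rewrite /D -(opprB x w) wipNl wipNr opprK.
  rewrite -(ler_pM2l a0).
  by move: (wip P _ _) (f x) (f w) hh => K A B; clear; lra.
rewrite -lerBrDl; apply/ler_addgt0Pl => e e0.
pose E := 2^-1 * h * D.
have E0 : 0 <= E by rewrite mulr_ge0// mulr_ge0 ?ltW.
(* This choice gives [0 < a < 1] and [a E <= e], which stands in for the limit. *)
pose a := e / (e + E + 1).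
have den : 0 < e + E + 1 by lra.
have a0 : 0 < a by rewrite divr_gt0.
have a1 : a < 1 by rewrite ltr_pdivrMr //; lra.
have := key a a0 a1; rewrite -/E.
have : a * E <= e.
  by rewrite /a mulrAC ler_pdivrMr // ler_pM2l //; lra.
lra.
Qed.

End Smoothness.

(** * Growth of the inverse step sizes *)

Section StepSize.
Variable R : realType.
Local Notation alpha := (step_size R).

Lemma step_size_gt0 t : 0 < alpha t.
Proof.
elim: t => [|t _] /=; first exact: ltr01.
by rewrite divr_gt0// ltr_pwDl// sqrtr_ge0.
Qed.

Lemma step_size_neq0 t : alpha t != 0.
Proof. by rewrite gt_eqF ?step_size_gt0. Qed.

(** The inverse step is the root [(1 + sqrt (1 + 4 b^2)) / 2] of [r^2 - r = b^2], with [b] the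
    inverse of the previous step. *)
Lemma step_sizeV t :
  (alpha t.+1)^-1 ^+ 2 - (alpha t.+1)^-1 = (alpha t)^-1 ^+ 2.
Proof.
rewrite /= invf_div -exprVn; set b := (alpha t)^-1.
have h : 0 <= 1 + 4 * b ^+ 2 by rewrite addr_ge0// mulr_ge0// sqr_ge0.
have := sqr_sqrtr h; move: (Num.sqrt _) => s hs.
have -> : b ^+ 2 = (s ^+ 2 - 1) / 4 by rewrite hs; field.
by field.
Qed.

(** The recurrence reads [(b' - 1/2)^2 = b^2 + 1/4], where [b' > 1]. *)
Lemma step_sizeV_ge t : (alpha t)^-1 + 2^-1 <= (alpha t.+1)^-1.
Proof.
have := step_sizeV t.
have : 0 < (alpha t)^-1 by rewrite invr_gt0 step_size_gt0.
have : 0 < (alpha t.+1)^-1 by rewrite invr_gt0 step_size_gt0.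
move: (alpha t.+1)^-1 (alpha t)^-1 => b' b b'0 b0 h.
have b'1 : 1 < b' by rewrite ltNge; apply/negP; nra.
by rewrite leNgt; apply/negP; nra.
Qed.

Lemma step_size_le t : alpha t <= 2 / (t.+2)%:R.
Proof.
have : (t.+2)%:R / 2 <= (alpha t)^-1.
  elim: t => [|t IH]; first by rewrite /= invr1; lra.
  by have := step_sizeV_ge t; move: IH; rewrite -[X in X / 2]natr1; lra.
have h : 0 < (t.+2)%:R / 2 :> R by rewrite divr_gt0.
move=> ?; rewrite -[leRHS]invf_div -[leLHS]invrK lef_pV2 // posrE.
by rewrite invr_gt0 step_size_gt0.
Qed.

Lemma step_size_le1 t : alpha t <= 1.
Proof.
by apply: le_trans (step_size_le t) _; rewrite ler_pdivrMr// mul1r ler_nat.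
Qed.

Lemma step_size_anti s t : (s <= t)%N -> alpha t <= alpha s.
Proof.
move=> /subnK <-; elim: (t - s)%N => // k; apply: le_trans.
rewrite -lef_pV2 ?posrE ?step_size_gt0//.
by apply: le_trans (step_sizeV_ge (k + s)); rewrite lerDl.
Qed.

End StepSize.

(** * Averaging and proximal inequalities for a single component *)

Section ProximalStep.
Variables (R : realType) (d : nat) (P : 'M[R]_d).
Hypothesis hP : sym_posdef P.
Implicit Types (f : 'rV[R]_d -> R) (G : 'rV[R]_d -> 'rV[R]_d).
Implicit Types (c w x y zbar : 'rV[R]_d).

(** Two tangent inequalities at the combined point; the weighted gradient terms cancel. *)
Lemma convex_smooth_comb l f x y (a : R) : 0 < a -> a <= 1 ->
  convex_smooth P l f ->
  f (a *: x + (1 - a) *: y) <= a * f x + (1 - a) * f y.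
Proof.
move=> a0 a1 [_ hf].
have /andP[hx _] := hf (a *: x + (1 - a) *: y) x.
have /andP[hy _] := hf (a *: x + (1 - a) *: y) y.
have b0 : 0 <= 1 - a by rewrite subr_ge0.
apply: le_trans (lerD (ler_wpM2l (ltW a0) hx) (ler_wpM2l b0 hy)).
move: (grad f _) (f (_ + _)) => g u.
by rewrite le_eqVlt; apply/orP; left; apply/eqP; rewrite !innerE; ring.
Qed.

Lemma averaging_scale (a u v r : R) : 0 < a ->
  (a^-1 * u - (1 - a) / a * v <= r) = (u - (1 - a) * v <= a * r).
Proof.
by move=> a0; rewrite -(ler_pM2l a0); congr (_ <= _); field; rewrite gt_eqF.
Qed.

(** Both the quadratic and the distance in [g] have curvature [h], so averaging leaves a surplus
    [a (1 - a) h |w - zbar|^2] of the right sign. *)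
Lemma quadratic_averaging h f x w zbar (a : R) : 0 < h -> 0 < a -> a <= 1 ->
  quadratic P h f ->
  let g := fun z => f z - f x + 2^-1 * h * wip P (z - x) (z - x) in
  a^-1 * g (a *: w + (1 - a) *: zbar) - (1 - a) / a * g zbar <= g w.
Proof.
move=> h0 a0 a1 qf /=.
rewrite (averaging_scale _ _ _ a0) (quadratic_convex_comb hP _ _ _ qf).
have -> : a *: w + (1 - a) *: zbar - x = a *: (w - x) + (1 - a) *: (zbar - x).
  by apply/rowP => j; rewrite !mxE; ring.
have D0 := wip_ge0 hP (w - zbar).
have -> : wip P (a *: (w - x) + (1 - a) *: (zbar - x))
    (a *: (w - x) + (1 - a) *: (zbar - x)) =
    a * wip P (w - x) (w - x) + (1 - a) * wip P (zbar - x) (zbar - x)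
    - a * (1 - a) * wip P (w - zbar) (w - zbar).
  rewrite !wipE (wipC hP zbar w) (wipC hP x w) (wipC hP x zbar).
  move: (wip P w w) (wip P w zbar) (wip P w x) (wip P zbar zbar) (wip P zbar x).
  by move: (wip P x x) => ? ? ? ? ? ?; ring.
have : 0 <= a * (1 - a) * h * wip P (w - zbar) (w - zbar).
  by rewrite !mulr_ge0 // ?subr_ge0 // ltW.
move: (wip P _ _) (wip P _ _) (wip P _ _) (f w) (f x) (f zbar).
by move=> ? ? ? ? ? ?; clear; lra.
Qed.

(** At [w] the rescaled function gives the value at the average exactly; at [x] convexity bounds
    [a * fhat x] by [a * f x + (1 - a) * f zbar]. *)
Lemma convex_averaging l f g x w zbar (a : R) : 0 < a -> a <= 1 ->
  convex_smooth P l f ->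
  let fhat z := a^-1 * f (a *: z + (1 - a) *: zbar) in
  let gap z := f z - f x + inner g (z - x) in
  a^-1 * gap (a *: w + (1 - a) *: zbar) - (1 - a) / a * gap zbar <=
  fhat w - fhat x + inner g (w - x).
Proof.
move=> a0 a1 sf /=.
have h := convex_smooth_comb x zbar a0 a1 sf.
rewrite (averaging_scale _ _ _ a0).
rewrite [a * (_ - _ + _)]mulrDr [a * (_ - _)]mulrBr !mulVKf ?gt_eqF //.
have -> : inner g (a *: w + (1 - a) *: zbar - x) =
    a * inner g (w - x) + (1 - a) * inner g (zbar - x).
  by rewrite !innerE; ring.
move: h; move: (f (_ + _)) (f (_ + _)) (inner _ _) (inner _ _) (f x) (f zbar).
by move=> ? ? ? ? ? ?; clear; lra.
Qed.

(* The extragradient correction costs [|u|^2 / H], with [u = P^-1 (G c - G w)];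
   it is absorbed by the slack [m |w - c|^2] left by the proximal term. *)
Lemma proximal_step l m b f G c w x (H := l + m) :
  0 <= l -> 0 <= b -> b <= m -> 0 < H ->
  convex_smooth P l f -> monotone_op G -> lipschitz_op P b G ->
  let prox := fun z =>
    2^-1 * H * wnorm P (z - c) ^+ 2 + inner z (grad f c + G c) in
  let c' := w + (G c - G w) *m invmx (H *: P) in
  f w - f x + inner (G x) (w - x) <=
  prox w - prox x + 2^-1 * H * wip P (w - x) (w - x) +
  2^-1 * H * (wip P (c - x) (c - x) - wip P (c' - x) (c' - x)).
Proof.
move=> l0 b0 bm H0 [_ sf] Gmono Glip /=.
set c' := w + _ *m _.
have H1 : H \is a GRing.unit by rewrite unitfE gt_eqF.
have Pu := posdef_unitmx hP.
pose u := (G c - G w) *m invmx P.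
have uE y : inner (G c - G w) y = wip P u y by exact: inner_wip.
have -> : c' = w + H^-1 *: u.
  by rewrite /c' invmxZ ?unitmxZ // -scalemxAr.
have /andP[_ hw] := sf c w; have /andP[hx _] := sf c x.
have hm := Gmono w x.
have hu : wip P u u <= b ^+ 2 * wip P (w - c) (w - c).
  have := Glip c w; rewrite (wnorm_inv hP) -/u => hb.
  have -> : wip P (w - c) (w - c) = wip P (c - w) (c - w).
    by rewrite -(opprB c w) wipNl wipNr opprK.
  rewrite -!(wnorm_sq hP) -exprMn ler_sqr ?nnegrE ?mulr_ge0 ?wnorm_ge0 //.
have N0 := wip_ge0 hP (w - c).
(* [b <= m <= H] gives [b^2 <= m H]. *)
have hHu : H^-1 * wip P u u <= m * wip P (w - c) (w - c).
  rewrite ler_pdivrMl //; apply: le_trans hu _; rewrite mulrA ler_wpM2r //.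
  rewrite /H; nra.
have eu : inner (G c - G w) (w - x) = wip P u (w - x) := uE _.
rewrite !(wnorm_sq hP).
(* The cross term of this expansion turns [<G c, w - x>] into [<G w, w - x>], which monotonicity
   compares with [<G x, w - x>]. *)
have -> : wip P (w + H^-1 *: u - x) (w + H^-1 *: u - x) =
    wip P (w - x) (w - x) + 2 * H^-1 * wip P u (w - x) + H^-1 ^+ 2 * wip P u u.
  by rewrite !wipE (wipC hP w u) (wipC hP x u); ring.
have eH (W V y U : R) :
    2^-1 * H * W + 2^-1 * H * (V - (W + 2 * H^-1 * y + H^-1 ^+ 2 * U)) =
    2^-1 * H * V - y - 2^-1 * (H^-1 * U).
  by field; rewrite gt_eqF.
rewrite -[X in _ <= X]addrA eH.
have -> : wip P (c - x) (c - x) = wip P (x - c) (x - c).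
  by rewrite -(opprB c x) wipNl wipNr opprK.
have slack : 2^-1 * l * wip P (w - c) (w - c) + 2^-1 * (H^-1 * wip P u u)
    <= 2^-1 * H * wip P (w - c) (w - c).
  by rewrite /H; nra.
have e1 : inner w (grad f c + G c) - inner x (grad f c + G c) =
    inner (grad f c) (w - c) - inner (grad f c) (x - c) + inner (G c) (w - x).
  rewrite !innerE (innerC w (grad f c)) (innerC w).
  by rewrite (innerC x (grad f c)) (innerC x); ring.
have e2 : inner (G w - G x) (w - x) = inner (G c) (w - x) -
    inner (G c - G w) (w - x) - inner (G x) (w - x).
  by rewrite !innerDl !innerNl; ring.
move: hm eu slack hw hx e1; rewrite e2.
move: (inner (G c - G w) _) (inner (G x) _) (inner (G c) _) => i1 i2 i3.
move: (inner (grad f c) (w - c)) (inner (grad f c) (x - c)) => i4 i5.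
move: (inner w _) (inner x _) => i6 i7.
move: (H^-1 * _) (wip P u _) => w1 w2.
move: (wip P _ _) (wip P _ _) (f c) (f w) (f x) => w3 w4 f1 f2 f3.
clear; lra.
Qed.

End ProximalStep.

(** * Weights and store updates of the recursion *)

Section Sliding.
Variables (R : realType) (d n : nat) (C : set 'rV[R]_d) (P : 'M[R]_d).
Variables (Q : nat -> 'rV[R]_d -> 'rV[R]_d) (L M : nat -> R) (T : nat -> nat).
Local Notation Z := 'rV[R]_d.
Local Notation alpha := (step_size R).
Local Notation H := (Hcoef L M alpha T).

Definition last_step k := alpha (T k).-1.

Definition step_prod (t : seq nat) : R :=
  \prod_(1 <= l < (size t).+1) alpha (nth 0%N t l.-1).

Definition ratio_prod (t : seq nat) : R :=
  \prod_(1 <= l < (size t).+1) (alpha (nth 0%N t l.-1) / last_step l).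

(* Coefficient of [|z^l - x|^2 / 2] in the estimate for [Rec] started at [t]:
   it equals the constant [H] at level [l], propagated upwards by
   [weight_rcons]. *)
Definition weight (t : seq nat) (l : nat) : R :=
  L l * step_prod t * \prod_((size t).+1 <= j < l.+1) last_step j ^+ 2 +
  M l * ratio_prod t * \prod_((size t).+1 <= j < l.+1) last_step j.

Lemma last_step_gt0 k : 0 < last_step k.
Proof. exact: step_size_gt0. Qed.

Lemma last_step_neq0 k : last_step k != 0.
Proof. exact: step_size_neq0. Qed.

Lemma prod_rcons (F : nat -> nat -> R) t s :
  \prod_(1 <= l < (size (rcons t s)).+1) F l (nth 0%N (rcons t s) l.-1) =
  (\prod_(1 <= l < (size t).+1) F l (nth 0%N t l.-1)) * F (size t).+1 s.
Proof.
rewrite size_rcons big_nat_recr //= nth_rcons ltnn eqxx; congr (_ * _).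
apply: eq_big_nat => l /andP[l1 l2]; rewrite nth_rcons.
by have -> : (l.-1 < size t)%N by lia.
Qed.

Lemma step_prod_rcons t s : step_prod (rcons t s) = step_prod t * alpha s.
Proof. exact: (prod_rcons (fun _ s => alpha s)). Qed.

Lemma ratio_prod_rcons t s :
  ratio_prod (rcons t s) = ratio_prod t * (alpha s / last_step (size t).+1).
Proof. exact: (prod_rcons (fun l s => alpha s / last_step l)). Qed.

Lemma step_prod_gt0 t : 0 < step_prod t.
Proof. by apply: prodr_gt0 => l _; exact: step_size_gt0. Qed.

Lemma ratio_prod_gt0 t : 0 < ratio_prod t.
Proof. by apply: prodr_gt0 => l _; rewrite divr_gt0 ?step_size_gt0. Qed.

Definition in_range (t : seq nat) :=
  forall l, (l < size t)%N -> (nth 0%N t l < T l.+1)%N.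

Lemma in_range_rcons t s : in_range t -> (s < T (size t).+1)%N ->
  in_range (rcons t s).
Proof.
move=> ht hs l; rewrite size_rcons ltnS leq_eqVlt nth_rcons => /orP[/eqP ->|lt].
  by rewrite ltnn eqxx.
by rewrite lt ht.
Qed.

(** Steps decrease and [t_l <= T_l - 1], so each factor is at least 1. Hence the scaled [M_i] still
    dominates the Lipschitz constant of [Q_i], which is never rescaled. *)
Lemma ratio_prod_ge1 t : in_range t -> 1 <= ratio_prod t.
Proof.
move=> ht; rewrite /ratio_prod big_seq.
apply: (big_ind (fun x => 1 <= x)) => // [x y|l]; first exact: mulr_ege1.
rewrite mem_index_iota => /andP[l1 l2].
rewrite ler_pdivlMr ?last_step_gt0 // mul1r; apply: step_size_anti.
by have := ht l.-1; rewrite prednK //; lia.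
Qed.

Lemma Hcoef_weight t : H (size t) t = weight t (size t).
Proof. by rewrite /weight !big_geq // !mulr1. Qed.

(** With [b] the last step of the new level, the [L] part gains [alpha s] and loses [b^2]; the [M]
    part gains [alpha s / b] and loses [b]. Both change by [alpha s / b^2], so dividing by [alpha s]
    removes the dependence on [s]. *)
Lemma weight_rcons t s l : (size t < l)%N ->
  weight (rcons t s) l =
  alpha s * (weight t l / last_step (size t).+1 ^+ 2).
Proof.
move=> tl; rewrite /weight step_prod_rcons ratio_prod_rcons size_rcons.
rewrite ![in RHS](big_ltn (m := (size t).+1)) //.
by field; exact: last_step_neq0.
Qed.

(** No key is also a source and the keys are distinct, so the successive assignments act as one
    simultaneous copy. *)
Lemma foldl_set_point (key src : nat -> seq nat) (r : seq nat)
    (z : seq nat -> Z) : {in r &, injective key} ->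
  (forall l l', src l' != key l) ->
  let z' := foldl (fun z l => set_point z (key l) (z (src l))) z r in
  (forall s, (forall l, l \in r -> s != key l) -> z' s = z s) /\
  (forall l, l \in r -> z' (key l) = z (src l)).
Proof.
elim: r z => [|a r IH] z inj sk /=; first by split.
have [|IH1 IH2] := IH (set_point z (key a) (z (src a))) _ sk.
  by move=> x y xr yr; apply: inj; rewrite inE ?xr ?yr orbT.
split=> [s hs|l].
  rewrite IH1 => [|l lr]; last by apply: hs; rewrite inE lr orbT.
  by rewrite /set_point (negbTE (hs a (mem_head _ _))).
rewrite inE; case: (boolP (l \in r)) => [lr _|lr].
  by rewrite IH2 // /set_point (negbTE (sk _ _)).
rewrite orbF => /eqP ->; have [ar|ar] := boolP (a \in r).
  by rewrite IH2 // /set_point (negbTE (sk _ _)).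
rewrite IH1 => [|l' l'r]; first by rewrite /set_point eqxx.
apply/negP => /eqP /inj e; move: ar; rewrite e ?inE ?l'r ?eqxx ?orbT //.
Qed.

(** The loop body of [Rec], named verbatim so that [RecS] holds by computation. *)
Definition iteration (m : nat) (t : seq nat) (p : nat -> Z -> R) (tk : nat)
    (zbar_z : Z * (seq nat -> Z)) : Z * (seq nat -> Z) :=
  let k := (size t).+1 in
  let: (zbar, z) := zbar_z in
  let tcur := rcons t tk in
  let tnext := rcons t tk.+1 in
  let: (zhalf, z) :=
    Rec n C P Q L M alpha T m tcur (pnew P Q L M alpha T tcur zbar (z tcur) p) z in
  let zbar := alpha tk *: zhalf + (1 - alpha tk) *: zbar in
  let DQ := Q k (z tcur) - Q k zhalf in
  let z := set_point z tnext (zhalf + DQ *m invmx (H k tcur *: P)) in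
  let z := foldl (fun z l =>
    set_point z (tnext ++ nseq (l - k) 0%N)
      (z (tcur ++ T k.+1 :: nseq (l - k.+1) 0%N))) z (index_iota k.+1 n.+1) in
  (zbar, z).

Lemma RecS m t p z :
  Rec n C P Q L M alpha T m.+1 t p z =
  iteri (T (size t).+1) (iteration m t p) (z (rcons t 0%N), z).
Proof. by []. Qed.

(** * Induction over the recursion levels *)

Hypotheses (hn : (1 <= n)%N) (hP : sym_posdef P).
Hypotheses (hC0 : C !=set0) (hCclosed : closed C).
Hypothesis hCconvex : forall x y a, C x -> C y -> 0 <= a -> a <= 1 ->
  C (a *: x + (1 - a) *: y).
Hypothesis hL : forall i, (1 <= i <= n)%N -> 0 <= L i.
Hypothesis hM : forall i, (1 <= i <= n)%N -> 0 <= M i.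
Hypothesis hLM : forall i, (1 <= i <= n)%N -> 0 < L i + M i.
Hypothesis hQmono : forall i, (1 <= i <= n)%N -> monotone_op (Q i).
Hypothesis hQlip : forall i, (1 <= i <= n)%N -> lipschitz_op P (M i) (Q i).
Hypothesis hT : forall k, (1 <= k <= n)%N -> (0 < T k)%N.

(** For [i < k] the linear part of [f i] already carries a value of [Q i]; the operator term gives
    way to the distance that strong convexity provides. *)
Definition gap_term (k : nat) (h : nat -> R) (f : nat -> Z -> R) (x : Z)
    (i : nat) (w : Z) : R :=
  f i w - f i x +
  if (i < k)%N then 2^-1 * h i * wip P (w - x) (w - x)
  else inner (Q i x) (w - x).

Definition gap k h f x w : R := \sum_(1 <= i < n.+1) gap_term k h f x i w.

Definition dist2 (x : Z) (z : seq nat -> Z) (s : seq nat) : R :=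
  wip P (z s - x) (z s - x).

Definition admissible (t : seq nat) (h : nat -> R) (f : nat -> Z -> R) :=
  [/\ in_range t,
   forall i, (1 <= i <= size t)%N -> 0 < h i /\ quadratic P (h i) (f i) &
   forall i, (size t < i <= n)%N -> convex_smooth P (L i * step_prod t) (f i)].

Lemma Hcoef_gt0 t : in_range t -> (1 <= size t <= n)%N -> 0 < H (size t) t.
Proof.
move=> ht hs; rewrite -[H _ _]/(L _ * step_prod t + M _ * ratio_prod t).
have := hL hs; rewrite le_eqVlt => /orP[/eqP L0|Lp].
  rewrite -L0 mul0r add0r mulr_gt0 ?ratio_prod_gt0 //.
  by have := hLM hs; rewrite -L0 add0r.
by rewrite ltr_wpDr ?mulr_gt0 ?step_prod_gt0 // mulr_ge0 ?hM // ltW ?ratio_prod_gt0.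
Qed.

Lemma phatE t tk (zbar z : Z) f i : (size t < i)%N ->
  phat alpha (rcons t tk) zbar f i z =
  (alpha tk)^-1 * f i (alpha tk *: z + (1 - alpha tk) *: zbar).
Proof. by move=> ti; rewrite /phat size_rcons last_rcons ti. Qed.

Lemma phat_convex_smooth t tk (zbar : Z) f i : (size t < i)%N ->
  convex_smooth P (L i * step_prod t) (f i) ->
  convex_smooth P (L i * step_prod (rcons t tk))
    (phat alpha (rcons t tk) zbar f i).
Proof.
move=> ti sf; rewrite step_prod_rcons mulrA mulrC.
have -> : phat alpha (rcons t tk) zbar f i = fun z =>
    (alpha tk)^-1 * f i (alpha tk *: z + (1 - alpha tk) *: zbar).
  by apply/funext => z; exact: phatE.
exact: convex_smooth_affine (step_size_gt0 R tk) sf.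
Qed.

Lemma pnew_admissible t tk h f (zbar c : Z) : (size t < n)%N ->
  (tk < T (size t).+1)%N -> admissible t h f ->
  admissible (rcons t tk)
    (fun i => if i == (size t).+1 then H i (rcons t tk) else h i)
    (pnew P Q L M alpha T (rcons t tk) zbar c f).
Proof.
move=> tn tkT [ht hq hs].
have ht' := in_range_rcons ht tkT.
split=> // i; rewrite size_rcons => /andP[i1 i2].
  rewrite /pnew size_rcons; case: eqP => [->|/eqP ik].
    split; last exact: quadratic_dist.
    by rewrite -(size_rcons t tk) Hcoef_gt0 // size_rcons.
  have it : (1 <= i <= size t)%N by rewrite i1; move: i2; rewrite leq_eqVlt (negbTE ik).
  have [h0 qf] := hq i it; split=> //.
  suff -> : phat alpha (rcons t tk) zbar f i = f i by [].
  by apply/funext => z; rewrite /phat size_rcons ltnNge (andP it).2.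
rewrite /pnew size_rcons gtn_eqF //.
by apply: phat_convex_smooth; [exact: ltnW|apply: hs; rewrite (ltnW i1)].
Qed.

(** For [i < k] this is averaging of quadratics, for [i > k] averaging of convex functions. For
    [i = k] averaging is followed by the proximal step, whose change of distance is the extra
    term. *)
Lemma gap_term_step t tk h f (zbar c x w : Z) i
    (k := (size t).+1) (tcur := rcons t tk)
    (c' := w + (Q k c - Q k w) *m invmx (H k tcur *: P)) :
  (size t < n)%N -> (tk < T (size t).+1)%N -> admissible t h f ->
  (1 <= i <= n)%N ->
  (alpha tk)^-1 * gap_term k h f x i (alpha tk *: w + (1 - alpha tk) *: zbar) -
  (1 - alpha tk) / alpha tk * gap_term k h f x i zbar <=
  gap_term k.+1 (fun i => if i == k then H i tcur else h i)
    (pnew P Q L M alpha T tcur zbar c f) x i w +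
  (if i == k then 2^-1 * H k tcur *
    (wip P (c - x) (c - x) - wip P (c' - x) (c' - x)) else 0).
Proof.
move=> tn tkT [ht hq hs] hi.
have ht' := in_range_rcons ht tkT.
have a0 := step_size_gt0 R tk; have a1 := step_size_le1 R tk.
rewrite /gap_term /pnew size_rcons -/k ltnS.
case: (ltngtP i k) => [ik|ik|ik].
- rewrite addr0.
  have it : (1 <= i <= size t)%N by rewrite (andP hi).1.
  have [h0 qf] := hq i it.
  have phf z : phat alpha tcur zbar f i z = f i z.
    by rewrite /phat size_rcons leqNgt ik.
  by rewrite !phf; exact: (quadratic_averaging hP x w zbar h0 a0 a1 qf).
- rewrite addr0.
  have it : (size t < i <= n)%N by rewrite (ltnW ik) (andP hi).2.
  rewrite !phatE ?(ltnW ik) //.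
  exact: (convex_averaging (Q i x) x w zbar a0 a1 (hs i it)).
rewrite {i}ik in hi *.
have sf : convex_smooth P (L k * step_prod t) (f k) by apply: hs; rewrite leqnn.
have hH : H k tcur = L k * step_prod tcur + M k * ratio_prod tcur.
  by [].
apply: le_trans (convex_averaging (Q k x) x w zbar a0 a1 sf) _.
rewrite -!(@phatE t) // -/tcur.
have := @proximal_step R d P hP (L k * step_prod tcur) (M k * ratio_prod tcur)
  (M k) (phat alpha tcur zbar f k) (Q k) c w x.
rewrite -hH; apply => //.
- by rewrite mulr_ge0 ?hL // ltW ?step_prod_gt0.
- exact: hM.
- by rewrite ler_peMr ?hM // ratio_prod_ge1.
- by have := Hcoef_gt0 ht'; rewrite size_rcons; apply.
- exact: phat_convex_smooth.
- exact: hQmono.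
- exact: hQlip.
Qed.

Lemma gap_step t tk h f (zbar c x w : Z)
    (k := (size t).+1) (tcur := rcons t tk)
    (c' := w + (Q k c - Q k w) *m invmx (H k tcur *: P)) :
  (size t < n)%N -> (tk < T (size t).+1)%N -> admissible t h f ->
  (alpha tk)^-1 * gap k h f x (alpha tk *: w + (1 - alpha tk) *: zbar) -
  (1 - alpha tk) / alpha tk * gap k h f x zbar <=
  gap k.+1 (fun i => if i == k then H i tcur else h i)
    (pnew P Q L M alpha T tcur zbar c f) x w +
  2^-1 * H k tcur * (wip P (c - x) (c - x) - wip P (c' - x) (c' - x)).
Proof.
move=> tn tkT adm.
rewrite /gap !mulr_sumr -sumrB.
set E := 2^-1 * _ * _.
(* The distance change becomes a sum with one nonzero term, so that the bound can be taken
   componentwise. *)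
have -> : E = \sum_(1 <= i < n.+1) if i == k then E else 0.
  by rewrite -big_mkcond big_nat1_eq ltnS tn.
rewrite -big_split /= !big_seq; apply: ler_sum => i.
by rewrite mem_index_iota ltnS => hi; exact: gap_term_step.
Qed.

(** The key is that of the level [l] point when level [size t + 1] stands at iteration [s] and all
    deeper indices are 0. *)
Definition decrease (t : seq nat) (x : Z) (z z' : seq nat -> Z)
    (e : nat -> R) (s s' : nat) : R :=
  \sum_((size t).+1 <= l < n.+1) 2^-1 * e l *
    (dist2 x z (rcons t s ++ nseq (l - (size t).+1) 0%N) -
     dist2 x z' (rcons t s' ++ nseq (l - (size t).+1) 0%N)).

(** The second clause is a frame property: a recursive call leaves the point of the calling level
    intact, so it can still be read for the correction. *)
Definition Rec_correct (m : nat) := forall t f h z,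
  (size t + m)%N = n -> admissible t h f ->
  let r := Rec n C P Q L M alpha T m t f z in
  [/\ C r.1, forall s, (size s <= size t)%N -> r.2 s = z s &
   forall x, C x -> gap (size t).+1 h f x r.1 <=
     decrease t x z r.2 (weight t) 0 (T (size t).+1)].

Lemma Rec_correct0 : Rec_correct 0.
Proof.
move=> t f h z; rewrite addn0 => tn [_ hq _] /=.
set F := fun x => _.
have hr i : i \in index_iota 1 n.+1 -> 0 < h i /\ quadratic P (h i) (f i).
  by rewrite mem_index_iota ltnS -tn; exact: hq.
have qF : quadratic P (\sum_(1 <= i < n.+1) h i) F.
  by apply: quadratic_sum => i /hr[].
have sh : 0 < \sum_(1 <= i < n.+1) h i.
  rewrite big_ltn ?ltnS // ltr_pwDl //.
    by apply: (hr 1%N _).1; rewrite mem_index_iota ltnS.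
  rewrite big_seq; apply: sumr_ge0 => i; rewrite mem_index_iota => /andP[i1 i2].
  by apply/ltW/(hr i _).1; rewrite mem_index_iota (ltnW i1).
have [Cw Hw] := argmin_quadratic hP hC0 hCclosed hCconvex sh qF.
(* No level remains, so the right-hand side is an empty sum and quadratic growth at the minimizer is
   the whole claim. *)
split=> // x Cx; rewrite /decrease big_geq ?tn //.
have -> : gap n.+1 h f x (argmin C F) = F (argmin C F) +
    2^-1 * (\sum_(1 <= i < n.+1) h i) *
      wip P (argmin C F - x) (argmin C F - x) - F x.
  move: (argmin C F) => w.
  rewrite -[RHS]addrAC [X in _ + X]mulrAC mulr_sumr /gap -sumrB -big_split /=.
  apply: eq_big_nat => i /andP[i1 i2].
  by rewrite /gap_term i2 mulrAC.
by rewrite subr_le0; exact: Hw.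
Qed.

(** The gap step supplies the decrease at the current level, the recursive call that at deeper
    levels. The witness [w] is exposed because it is known to lie in [C], the average not yet. *)
Lemma iteration_correct m t f h tk zbar z : Rec_correct m ->
  (size t + m.+1)%N = n -> (tk < T (size t).+1)%N -> admissible t h f ->
  let r := iteration m t f tk (zbar, z) in
  exists w, [/\ C w, r.1 = alpha tk *: w + (1 - alpha tk) *: zbar,
    forall s, (size s <= size t)%N -> r.2 s = z s &
    forall x, C x ->
      (alpha tk)^-1 * gap (size t).+1 h f x r.1 -
      (1 - alpha tk) / alpha tk * gap (size t).+1 h f x zbar <=
      decrease t x z r.2 (weight (rcons t tk)) tk tk.+1].
Proof.
move=> IH tm tkT adm.
have tn : (size t < n)%N by lia.
have tm' : (size (rcons t tk) + m)%N = n by rewrite size_rcons; lia.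
have := IH _ _ _ z tm' (pnew_admissible zbar (z (rcons t tk)) tn tkT adm).
rewrite /iteration; case: (Rec _ _ _ _ _ _ _ _ _ _ _ _) => w z1 /= [Cw fr Hw].
exists w; rewrite fr //.
set k := (size t).+1; set c := z (rcons t tk); set c' := w + _ *m _.
pose key l := rcons t tk.+1 ++ nseq (l - k) 0%N.
pose src l := rcons t tk ++ T k.+1 :: nseq (l - k.+1) 0%N.
have key_inj : {in index_iota k.+1 n.+1 &, injective key}.
  move=> l l'; rewrite !mem_index_iota => /andP[kl _] /andP[kl' _].
  move=> /(congr1 size); rewrite !size_cat !size_nseq; lia.
(* The keys differ at position [size t]: one has [tk] there, the other [tk + 1]. *)
have src_key l l' : src l' != key l.
  apply/eqP => /(congr1 (nth 0%N ^~ (size t))).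
  by rewrite !nth_cat !size_rcons ltnSn !nth_rcons ltnn eqxx; lia.
have size_key l : (k <= size (key l))%N by rewrite size_cat size_rcons leq_addr.
have [] := foldl_set_point (set_point z1 (rcons t tk.+1) c') key_inj src_key.
set z3 := foldl _ _ _ => old new.
have z3k : z3 (rcons t tk.+1) = c'.
  rewrite old; first by rewrite /set_point eqxx.
  move=> l; rewrite mem_index_iota => /andP[kl _].
  apply/eqP => /(congr1 size); rewrite size_cat size_nseq; lia.
split=> // [s hs|x Cx].
  rewrite old => [|l _].
    rewrite /set_point; case: eqP => [e|_]; first by move: hs; rewrite e size_rcons ltnn.
    by apply: fr; rewrite size_rcons ltnW.
  by apply/eqP => e; have := size_key l; rewrite -e ltnNge hs.
apply: le_trans (gap_step zbar c x w tn tkT adm) _.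
rewrite /decrease big_ltn ?ltnS // subnn !cats0 addrC.
have := Hcoef_weight (rcons t tk); rewrite size_rcons => <-.
rewrite /dist2 z3k; apply: lerD => //.
have := Hw x Cx; rewrite size_rcons => /le_trans; apply.
rewrite /decrease size_rcons le_eqVlt; apply/orP; left; apply/eqP.
(* The recursive call ends at index [T k.+1] of level [k + 1]; the copying loop moves that point to
   the starting key of the next iteration. *)
apply: eq_big_nat => l /andP[kl ln].
have lk : (l - k)%N = (l - k.+1).+1 by lia.
rewrite -[rcons t tk.+1 ++ _]/(key l) new ?mem_index_iota ?kl // /set_point.
rewrite /src lk -!cat_rcons.
case: eqP => [/(congr1 size)|_ //].
by rewrite size_cat !size_rcons; lia.
Qed.

(** The inequality of iteration [s] is divided by [alpha s]. Its gap coefficients become [inv_sq] at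
    [s + 1] and [s], and its weights become [e], free of [s], so the sum telescopes. *)
Lemma Rec_correctS m : Rec_correct m -> Rec_correct m.+1.
Proof.
move=> IH t f h z tm adm; rewrite RecS; set k := (size t).+1.
have hk : (1 <= k <= n)%N by rewrite /k; lia.
(* The value 0 at [s = 0] is [(1 - alpha 0) / alpha 0 ^+ 2]: the initial average,
   which need not lie in [C], has weight 0. *)
pose inv_sq s : R := if s is s'.+1 then (alpha s')^-1 ^+ 2 else 0.
have inv_sqE s : inv_sq s = (alpha s)^-1 * ((1 - alpha s) / alpha s).
  case: s => [|s]; first by rewrite /= subrr mul0r mulr0.
  rewrite /inv_sq -step_sizeV; move: (alpha s.+1) (step_size_neq0 R s.+1).
  by move=> a a0; field.
pose e l := weight t l / last_step k ^+ 2.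
have loop s : (s <= T k)%N ->
    let r := iteri s (iteration m t f) (z (rcons t 0%N), z) in
    [/\ (0 < s)%N -> C r.1,
      forall u, (size u <= size t)%N -> r.2 u = z u &
      forall x, C x -> inv_sq s * gap k h f x r.1 <= decrease t x z r.2 e 0 s].
  elim: s => [_|s IHs sT] /=.
    split=> // x _; rewrite mul0r /decrease big1 // => l _.
    by rewrite subrr mulr0.
  have [] := IHs (ltnW sT).
  case: (iteri s _ _) => zbar z1 /= IC IF IG.
  have [w [Cw zE fr Hw]] := iteration_correct zbar z1 IH tm sT adm.
  split=> [_|u hu|x Cx]; last 1 first.
  - have := Hw x Cx; rewrite -(ler_pM2l (_ : 0 < (alpha s)^-1)); last first.
      by rewrite invr_gt0 step_size_gt0.
    rewrite mulrBr [_ * (_ * gap _ _ _ _ zbar)]mulrA -inv_sqE mulrA -expr2.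
    move=> h1; have := lerD h1 (IG x Cx); rewrite subrK => /le_trans; apply.
    rewrite /decrease mulr_sumr -big_split /= le_eqVlt; apply/orP; left.
    apply/eqP/eq_big_nat => l /andP[kl _].
    rewrite weight_rcons // -/k -/(e l); move: (step_size_neq0 R s).
    move: (alpha s) (e l) (dist2 _ _ _) (dist2 _ _ _) (dist2 _ _ _).
    by move=> a el d1 d2 d3 a0; field.
  (* At [s = 0] the step is 1 and the average is [w]; afterwards both averaged points lie in [C]. *)
  - rewrite zE; case: s {IHs IG inv_sqE Hw zE fr} sT IC Cw => [|s] sT IC Cw.
      by rewrite /= subrr scale0r addr0 scale1r.
    apply: hCconvex => //; first exact: IC.
      exact: ltW (step_size_gt0 _ _).
    exact: step_size_le1.
  - by rewrite fr // IF.
have [] := loop _ (leqnn _); set r := iteri _ _ _ => rC rF rG.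
split=> [| |x Cx]; [exact: rC (hT hk)|exact: rF|].
(* After [T k] iterations the coefficient is the inverse square of the last step; clearing it turns
   [e] back into [weight t]. *)
have := rG x Cx; rewrite -(prednK (hT hk)) [inv_sq _]/= -/(last_step k).
rewrite exprVn ler_pdivrMl ?exprn_gt0 ?last_step_gt0 // prednK ?hT //.
move=> /le_trans; apply; rewrite /decrease mulr_sumr le_eqVlt; apply/orP; left.
apply/eqP/eq_big_nat => l _; rewrite /e; move: (last_step k) (last_step_neq0 k).
move: (dist2 _ _ _) (dist2 _ _ _) => d1 d2 b b0.
by field.
Qed.

Lemma Rec_correctP m : Rec_correct m.
Proof. by elim: m => [|m IH]; [exact: Rec_correct0|exact: Rec_correctS]. Qed.

(** * Explicit constants and the final bound *)

Lemma prod_le_div (F G : nat -> R) (c : R) i :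
  (forall j, (1 <= j <= i)%N -> 0 <= F j <= c / G j) ->
  \prod_(1 <= j < i.+1) F j <= c ^+ i / \prod_(1 <= j < i.+1) G j.
Proof.
move=> hF; have -> : c ^+ i = \prod_(1 <= j < i.+1) c.
  by rewrite prodr_const_nat subn1.
rewrite -prodfV -big_split /= !big_seq; apply: ler_prod => j.
by rewrite mem_index_iota ltnS; exact: hF.
Qed.

(** The bound [2 / (T k + 1)] on the last step is relaxed to [2 / T k]. *)
Lemma last_step_le k : (1 <= k <= n)%N -> last_step k <= 2 / (T k)%:R.
Proof.
move=> hk; have Tk := hT hk; apply: le_trans (step_size_le R _) _.
by rewrite ler_pM2l // lef_pV2 ?posrE ?ltr0n // ler_nat prednK.
Qed.

(** At the root the scaling products are empty. Squared last steps accompany [L i] and give [4^i];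
    plain ones accompany [M i] and give [2^i]. *)
Lemma weight_nil_le i : (1 <= i <= n)%N ->
  weight [::] i <= 4 ^+ i * L i / \prod_(1 <= j < i.+1) (T j)%:R ^+ 2 +
    2 ^+ i * M i / \prod_(1 <= j < i.+1) (T j)%:R.
Proof.
move=> hi; rewrite /weight (big_geq (leqnn 1) : step_prod [::] = 1).
rewrite (big_geq (leqnn 1) : ratio_prod [::] = 1) !mulr1 /=.
have hj j : (1 <= j <= i)%N -> 0 <= last_step j <= 2 / (T j)%:R.
  move=> /andP[j1 ji]; rewrite ltW ?last_step_gt0 //= last_step_le // j1.
  by rewrite (leq_trans ji) ?(andP hi).2.
apply: lerD; rewrite [X in X / _]mulrC -mulrA ler_wpM2l ?hL ?hM //.
  apply: prod_le_div => j /hj /andP[l0 l1]; rewrite sqr_ge0 /=.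
  have -> : 4 / (T j)%:R ^+ 2 = (2 / (T j)%:R) ^+ 2 :> R.
    by rewrite expr_div_n; congr (_ / _); ring.
  by rewrite lerXn2r // nnegrE (le_trans l0 l1).
exact: prod_le_div.
Qed.

Lemma algorithm_correct (p : nat -> Z -> R) (zin : Z) :
  (forall i, (1 <= i <= n)%N -> convex_smooth P (L i) (p i)) ->
  let zout := algorithm n C P Q L M alpha T p zin in
  C zout /\ forall z, C z ->
    \sum_(1 <= i < n.+1) (p i zout - p i z + inner (Q i z) (zout - z)) <=
    (\sum_(1 <= i < n.+1)
       (4 ^+ i * L i / \prod_(1 <= j < i.+1) (T j)%:R ^+ 2 +
        2 ^+ i * M i / \prod_(1 <= j < i.+1) (T j)%:R))
    * (2^-1 * wnorm P (zin - z) ^+ 2).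
Proof.
move=> hp zout; set z0 := fun s : seq nat => if all (pred1 0%N) s then zin else 0.
(* At the root no component is quadratic yet; the curvature 1 is a filler. *)
have adm : admissible [::] (fun=> 1) p.
  split=> // [i|i /hp]; first by case: i.
  by rewrite /step_prod big_geq // mulr1.
have [Cw _ Hw] := @Rec_correctP n [::] p (fun=> 1) z0 erefl adm.
split=> // z Cz; move: (Hw z Cz); rewrite {1}/gap.
rewrite (eq_big_nat _ _ (F2 := fun i =>
  p i zout - p i z + inner (Q i z) (zout - z))); last first.
  by move=> i /andP[i1 _]; rewrite /gap_term ltnNge i1.
move=> /le_trans; apply; rewrite mulr_suml /decrease !big_seq.
apply: ler_sum => i; rewrite mem_index_iota ltnS => hi.
have -> : dist2 z z0 (rcons [::] 0%N ++ nseq (i - 1) 0%N) = wnorm P (zin - z) ^+ 2.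
  by rewrite (wnorm_sq hP) /dist2 /z0 /= all_nseq orbT.
have D0 : 0 <= wnorm P (zin - z) ^+ 2 by exact: sqr_ge0.
have W0 : 0 <= weight [::] i.
  rewrite /weight addr_ge0 // mulr_ge0 ?prodr_ge0 // => [|j _||j _].
  - by rewrite mulr_ge0 ?hL // ltW ?step_prod_gt0.
  - exact: sqr_ge0.
  - by rewrite mulr_ge0 ?hM // ltW ?ratio_prod_gt0.
  - exact/ltW/last_step_gt0.
apply: (@le_trans _ _ (2^-1 * weight [::] i * wnorm P (zin - z) ^+ 2)).
  by rewrite ler_wpM2l ?mulr_ge0 // gerBl; exact: wip_ge0.
by rewrite -mulrA [leRHS]mulrCA ler_pM2l // ler_wpM2r // weight_nil_le.
Qed.

End Sliding.

Theorem theorem3 (R : realType) (d n : nat) (C : set 'rV[R]_d) (P : 'M[R]_d)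
    (p : nat -> 'rV[R]_d -> R) (Q : nat -> 'rV[R]_d -> 'rV[R]_d)
    (L M : nat -> R) (T : nat -> nat) (zin : 'rV[R]_d)
    (hn : (1 <= n)%N)
    (hC0 : C !=set0) (hCclosed : closed C) (hCconvex : convex_set C)
    (hP : sym_posdef P)
    (hp : forall i, (1 <= i <= n)%N -> forall x, differentiable (p i) x)
    (hL : forall i, (1 <= i <= n)%N -> 0 <= L i)
    (hM : forall i, (1 <= i <= n)%N -> 0 <= M i)
    (hLM : forall i, (1 <= i <= n)%N -> 0 < L i + M i)
    (hpmono : forall i, (1 <= i <= n)%N -> monotone_op (grad (p i)))
    (hplip : forall i, (1 <= i <= n)%N -> lipschitz_op P (L i) (grad (p i)))
    (hQmono : forall i, (1 <= i <= n)%N -> monotone_op (Q i))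
    (hQlip : forall i, (1 <= i <= n)%N -> lipschitz_op P (M i) (Q i))
    (hT : forall k, (1 <= k <= n)%N -> (0 < T k)%N)
    (hzin : C zin) :
  let ptot := fun z => \sum_(1 <= i < n.+1) p i z in
  let Qtot := fun z => \sum_(1 <= i < n.+1) Q i z in
  let zout := algorithm n C P Q L M (step_size R) T p zin in
  C zout /\
  forall z, C z ->
    ptot zout - ptot z + inner (Qtot z) (zout - z) <=
    (\sum_(1 <= i < n.+1)
       (4 ^+ i * L i / \prod_(1 <= j < i.+1) (T j)%:R ^+ 2 +
        2 ^+ i * M i / \prod_(1 <= j < i.+1) (T j)%:R))
    * (2^-1 * wnorm P (zin - z) ^+ 2).
Proof.
move=> ptot Qtot zout.
(* [convex_set] takes its weights from an interval type; this is the form with a real weight. *)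
have hCc x y a : C x -> C y -> 0 <= a -> a <= 1 -> C (a *: x + (1 - a) *: y).
  move=> Cx Cy a0 a1; have := hCconvex x y (Itv01 a0 a1).
  by rewrite !inE; apply.
have hp' i : (1 <= i <= n)%N -> convex_smooth P (L i) (p i).
  by move=> hi; apply: convex_smooth_lipschitz;
    [|exact: hp|exact: hpmono|exact: hplip].
have [Cz bound] := algorithm_correct hn hP hC0 hCclosed hCc hL hM hLM hQmono
  hQlip hT zin hp'.
split=> // z Cz'; have := bound z Cz'.
by rewrite big_split sumrB /= -inner_suml.
Qed.
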